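(* Let $Y_1\sim P(\alpha)$ (Poisson with mean $\alpha>0$) and $Y_2\sim Bi(M,p)$ ($M\in\mathbb{N}$, $0<p<1$, $q=1-p$) be independent, so that $Y_{12}=Y_1+Y_2$ has probability generating function $(q+pz)^M\exp\{\alpha(z-1)\}$. Then a Stein operator for $Y_{12}$ is $$(\mathcal{A}g)(j)=(Mp+\alpha-jp)g(j+1)-jq\,g(j)+p\alpha\,\Delta g(j+1),\quad j\in\mathbb{Z}_+,\ g\in\mathcal{G}_{Y_{12}},$$ i.e. $\mathbb{E}(\mathcal{A}g)(Y_{12})=0$ for every $g\in\mathcal{G}_{Y_{12}}$. If in addition $p<q$, then also $$(\mathcal{A}g)(j)=(\alpha+Mp)g(j+1)-j\,g(j)+M\sum_{l=2}^\infty(-1)^{l+1}\Big(\frac pq\Big)^l\sum_{k=1}^{l-1}\Delta g(j+k),\quad j\in\mathbb{Z}_+,\ g\in\mathcal{G}_{Y_{12}},$$ is a Stein operator for $Y_{12}$, i.e. it satisfies $\mathbb{E}(\mathcal{A}g)(Y_{12})=0$ for every $g\in\mathcal{G}_{Y_{12}}$.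
   Context: $\mathbb{Z}_+=\{0,1,2,\dots\}$. $\Delta g(j)=g(j+1)-g(j)$. For a $\mathbb{Z}_+$-valued random variable $Y$ with finite mean, $\mathcal{G}_Y$ is the set of bounded functions $g:\mathbb{Z}_+\to\mathbb{R}$ with $g(0)=0$ and $g(x)=0$ for $x\notin \mathrm{supp}(Y)$. A Stein operator for $Y$ is a linear operator $\mathcal{A}$ such that $\mathbb{E}(\mathcal{A}g)(Y)=0$ for all $g\in\mathcal{G}_Y$. *)

(* Defs.v *)
From HB Require Import structures.
From mathcomp Require Import all_boot all_order all_algebra.
From mathcomp Require Import all_classical all_reals all_analysis.
From mathcomp Require Import measurable_realfun.
Import Order.TTheory GRing.Theory Num.Theory.
Import numFieldNormedType.Exports.

Set Implicit Arguments.
Unset Strict Implicit.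
Unset Printing Implicit Defensive.

Local Open Scope classical_set_scope.
Local Open Scope ring_scope.

Definition independent_RV (d d1 d2 : measure_display) (T : measurableType d)
    (T1 : measurableType d1) (T2 : measurableType d2) (R : realType)
    (P : probability T R) (X1 : {RV P >-> T1}) (X2 : {RV P >-> T2}) : Prop :=
  forall (A : set T1) (B : set T2), measurable A -> measurable B ->
    P (X1 @^-1` A `&` X2 @^-1` B) = (P (X1 @^-1` A) * P (X2 @^-1` B))%E.

Section nat_valued.
Context (d : measure_display) (T : measurableType d) (R : realType)
  (P : probability T R).

Definition addRV (X Y : {RV P >-> nat}) : T -> nat := fun w => (X w + Y w)%N.

Lemma measurable_addRV (X Y : {RV P >-> nat}) :
  measurable_fun [set: T] (addRV X Y).
Proof. by apply: measurable_fun_addn; exact: measurable_funPT. Qed.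

HB.instance Definition _ (X Y : {RV P >-> nat}) :=
  isMeasurableFun.Build _ _ _ _ (addRV X Y) (measurable_addRV X Y).

(* The last argument of [poisson_prob] is shadowed in its body, so the measure
   does not depend on it. *)
Definition poisson_distributed (alpha : R) (Y : {RV P >-> nat}) : Prop :=
  forall A : set nat, distribution P Y A = poisson_prob alpha 0 A.

Definition binomial_distributed (M : nat) (p : R) (Y : {RV P >-> nat}) : Prop :=
  forall A : set nat, distribution P Y A = binomial_prob M p A.

Definition pgf (Y : {RV P >-> nat}) (z : R) : \bar R :=
  ('E_P[fun w => (z ^+ Y w)%R])%E.

Definition supp (Y : {RV P >-> nat}) : set nat :=
  [set k | (0 < P (Y @^-1` [set k]))%E].

Definition stein_class (Y : {RV P >-> nat}) : set (nat -> R) :=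
  [set g | [/\ bounded_fun g, g 0%N = 0 & forall x, ~ supp Y x -> g x = 0]].

(* The integral of a function that is not integrable has a conventional value,
   hence the explicit integrability in the last clause. Linearity is only asked
   on [stein_class Y], because an operator given by a series need not be
   meaningful on every function. *)
Definition is_stein_operator (Y : {RV P >-> nat})
    (A : (nat -> R) -> nat -> R) : Prop :=
  [/\ P.-integrable [set: T] (fun w => ((Y w)%:R : R)%:E),
      forall (a : R) (g h : nat -> R), stein_class Y g -> stein_class Y h ->
        forall j, A (fun x => a * g x + h x) j = a * A g j + A h j
    & forall g, stein_class Y g ->
        P.-integrable [set: T] (fun w => (A g (Y w))%:E) /\
        ('E_P[fun w => A g (Y w)] = 0)%E].

End nat_valued.

Definition fdiff (R : realType) (g : nat -> R) (j : nat) : R := g j.+1 - g j.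

(* Main.v *)
(* Conditionally on one summand, the recursions satisfied by the Poisson and the
   binomial weights give, for bounded f and S = Y1 + Y2,
     E[S (q f(S) + p f(S+1))]
       = E[M p f(S+1) + alpha (q f(S+1) + p f(S+2))].
   It is first proved for f >= 0, where both sides are integrals of nonnegative
   functions, which also gives the finiteness of E[S]; adding a constant to f
   reaches every bounded f. The first operator is the case f = - g. For the
   second one, put r = p / q < 1 and f(j+1) = - h(j) / p, where
   h(j) = sum_(l >= 1) (-1)^(l+1) r^l g(j+l) solves
   q h(j) + p h(j+1) = p g(j+1); the telescoping inner sums turn the series of
   the statement into h(j) - p g(j+1). *)

Require Import Defs.
From mathcomp Require Import all_boot all_order all_algebra ring lra.
From mathcomp Require Import all_classical all_reals all_analysis.
From mathcomp Require Import measurable_realfun.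

Set Implicit Arguments.
Unset Strict Implicit.
Unset Printing Implicit Defensive.

Import Order.TTheory GRing.Theory Num.Theory.
Import numFieldNormedType.Exports.
Local Open Scope classical_set_scope.
Local Open Scope ring_scope.

(** * Measurability and integration through the values of integer random variables *)

Lemma measurable_preimage_nat (d : measure_display) (T : measurableType d)
    (X : T -> nat) (A : set nat) :
  measurable_fun [set: T] X -> measurable (X @^-1` A).
Proof. by move=> mX; rewrite -[X in measurable X]setTI; exact: mX. Qed.

(** The preimage of a set splits along the countably many values of [X], and every subset of [nat]
    is measurable; so any [F] can be used, in particular weights that depend on both summands. *)
Lemma measurable_fun_nat2 (d d' : measure_display) (T : measurableType d)
    (T' : measurableType d') (X Y : T -> nat) (F : nat -> nat -> T') :
  measurable_fun [set: T] X -> measurable_fun [set: T] Y ->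
  measurable_fun [set: T] (fun w => F (X w) (Y w)).
Proof.
move=> mX mY _ B mB; rewrite setTI.
rewrite (_ : _ @^-1` B =
    \bigcup_i (X @^-1` [set i] `&` Y @^-1` [set j | B (F i j)])); last first.
  apply/seteqP; split => w /=; first by exists (X w).
  by case=> i _ [/= ->].
by apply: bigcupT_measurable => i; apply: measurableI;
  exact: measurable_preimage_nat.
Qed.

Lemma ge0_integral_fibers (d : measure_display) (T : measurableType d)
    (R : realType) (mu : {measure set T -> \bar R}) (D : set T) (X : T -> nat)
    (f : T -> \bar R) :
  measurable D -> measurable_fun [set: T] X -> measurable_fun D f ->
  (forall w, D w -> (0 <= f w)%E) ->
  (\int[mu]_(w in D) f w =
   \sum_(i <oo) \int[mu]_(w in D `&` X @^-1` [set i]) f w)%E.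
Proof.
move=> mD mX mf f0.
have DE : D = \bigcup_i (D `&` X @^-1` [set i]).
  by apply/seteqP; split => [w Dw|w [i _ []]//]; exists (X w).
rewrite {1}DE ge0_integral_bigcup -?DE//.
  by move=> i; apply: measurableI => //; exact: measurable_preimage_nat.
by move=> i j _ _ [w [[_ /= <-] [_ /= <-]]].
Qed.

(** The integral is cut along the fibers of [X], then of [Y]. On each resulting piece [F] is
    constant, and independence makes the mass of the piece a product. *)
Lemma ge0_integral_indep (d : measure_display) (T : measurableType d)
    (R : realType) (P : probability T R) (X Y : {RV P >-> nat})
    (F : nat -> nat -> \bar R) :
  independent_RV X Y -> (forall i j, (0 <= F i j)%E) ->
  (\int[P]_w F (X w) (Y w) = \sum_(i <oo) \sum_(j <oo)
     (F i j * (distribution P X [set i] * distribution P Y [set j])))%E.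
Proof.
move=> XY F0; have mX : measurable_fun setT X by exact: measurable_funPT.
have mY : measurable_fun setT Y by exact: measurable_funPT.
rewrite (ge0_integral_fibers P measurableT mX)//; last exact: measurable_fun_nat2.
apply: eq_eseriesr => i _; rewrite setTI.
have mXi := measurable_preimage_nat [set i] mX.
rewrite (ge0_integral_fibers P mXi mY)//; last first.
  by apply: measurable_funTS; exact: measurable_fun_nat2.
apply: eq_eseriesr => j _.
transitivity (\int[P]_(w in X @^-1` [set i] `&` Y @^-1` [set j]) cst (F i j) w)%E.
  by apply: eq_integral => w; rewrite inE => -[/= -> ->].
rewrite integral_cst.
- by congr (_ * _)%E; exact: XY.
- by apply: measurableI => //; exact: measurable_preimage_nat.
Qed.

(** * Point weights and their recursions *)

Lemma nneseries_shift (R : realType) (u : nat -> \bar R) :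
  (forall i, 0 <= u i)%E -> u 0%N = 0%E ->
  (\sum_(i <oo) u i = \sum_(i <oo) u i.+1)%E.
Proof.
move=> u0 u00; rewrite nneseries_recl// u00 add0e -nneseries_addn//.
by apply: eq_eseriesr => i _; rewrite addn1.
Qed.

Lemma poisson_pmfS (R : realType) (alpha : R) (i : nat) : 0 < alpha ->
  i.+1%:R * poisson_pmf alpha i.+1 = alpha * poisson_pmf alpha i.
Proof.
move=> a0; rewrite /poisson_pmf a0 factS natrM exprS.
have i0 : i.+1%:R != 0 :> R by rewrite pnatr_eq0.
have f0 : i`!%:R != 0 :> R by rewrite pnatr_eq0 -lt0n fact_gt0.
by field; rewrite nat1r i0 f0.
Qed.

(** The source is [(j+1) C(M,j+1) = (M-j) C(M,j)]. In this division-free form the recursion holds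
    for every [j], also at and beyond the end [M] of the support. *)
Lemma binomial_pmfS (R : realType) (M : nat) (p : R) (j : nat) :
  (1 - p) * j.+1%:R * binomial_pmf M p j.+1 + p * j%:R * binomial_pmf M p j =
  M%:R * p * binomial_pmf M p j.
Proof.
have pmfE k : binomial_pmf M p k = p ^+ k * (1 - p) ^+ (M - k) * 'C(M, k)%:R.
  by rewrite mulr_natr.
rewrite !pmfE {pmfE}.
have [Mj|jM] := ltnP M j; first by rewrite !bin_small ?leqW// !mulr0n !mulr0 addr0.
have E : j.+1%:R * 'C(M, j.+1)%:R = (M%:R - j%:R) * 'C(M, j)%:R :> R.
  by rewrite -natrB// -!natrM mul_bin_left.
(* At [j = M] the truncated subtraction gives [M - j.+1 = M - j], so the factor [1 - p] cannot be
   extracted from the power; there [C(M,M+1) = 0] settles the claim. *)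
have [->|jltM] := eqVneq j M.
  by rewrite bin_small// mulr0n !mulr0 add0r; ring.
have {}jltM : (j < M)%N by rewrite ltn_neqAle jltM.
rewrite -(subnSK jltM) !exprS.
transitivity ((1 - p) * p * p ^+ j * (1 - p) ^+ (M - j.+1) *
   (j.+1%:R * 'C(M, j.+1)%:R + j%:R * 'C(M, j)%:R)); first ring.
by rewrite E; ring.
Qed.

Lemma poisson_distributed1 (d : measure_display) (T : measurableType d)
    (R : realType) (P : probability T R) (alpha : R) (X : {RV P >-> nat})
    (i : nat) :
  0 < alpha -> poisson_distributed alpha X ->
  distribution P X [set i] = (poisson_pmf alpha i)%:E.
Proof.
move=> a0 ->; rewrite /poisson_prob a0 esum_set1//.
by rewrite lee_fin poisson_pmf_ge0.
Qed.

Lemma binomial_distributed1 (d : measure_display) (T : measurableType d)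
    (R : realType) (P : probability T R) (M : nat) (p : R) (Y : {RV P >-> nat})
    (j : nat) :
  0 <= p <= 1 -> binomial_distributed M p Y ->
  distribution P Y [set j] = (binomial_pmf M p j)%:E.
Proof.
move=> p01 ->; rewrite /binomial_prob p01 esum_set1//.
by rewrite lee_fin binomial_pmf_ge0.
Qed.

(** * Stein identities for each summand and for the sum *)

Section stein_identities.
Context (d : measure_display) (T : measurableType d) (R : realType)
  (P : probability T R) (X Y : {RV P >-> nat}).
Hypothesis indepXY : independent_RV X Y.

(** The term [i = 0] vanishes through its factor [i]; after shifting [i], [poisson_pmfS] matches the
    two series term by term. Keeping both values in [F] allows functions of the sum [X + Y]. *)
Lemma poisson_stein (alpha : R) (F : nat -> nat -> R) :
  0 < alpha -> poisson_distributed alpha X -> (forall i j, 0 <= F i j) ->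
  (\int[P]_w ((X w)%:R * F (X w) (Y w))%:E =
   \int[P]_w (alpha * F (X w).+1 (Y w))%:E)%E.
Proof.
move=> a0 Xa F0.
rewrite (ge0_integral_indep (F := fun i j => (i%:R * F i j)%:E) indepXY);
  last by move=> i j; rewrite lee_fin mulr_ge0.
rewrite (ge0_integral_indep (F := fun i j => (alpha * F i.+1 j)%:E) indepXY);
  last by move=> i j; rewrite lee_fin mulr_ge0// ltW.
have pos i j : (0 <= (i%:R * F i j)%:E *
    (distribution P X [set i] * distribution P Y [set j]))%E.
  by rewrite mule_ge0 ?mule_ge0// lee_fin mulr_ge0.
rewrite nneseries_shift; first last.
- by rewrite eseries0// => j _ _; rewrite mul0r mul0e.
- by move=> i; apply: nneseries_ge0.
apply: eq_eseriesr => i _; apply: eq_eseriesr => j _.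
rewrite !(poisson_distributed1 _ a0 Xa) !muleA -!EFinM; congr (_%:E * _)%E.
by rewrite mulrAC poisson_pmfS// mulrAC.
Qed.

Lemma binomial_stein (M : nat) (p : R) (F : nat -> nat -> R) :
  0 <= p <= 1 -> binomial_distributed M p Y -> (forall i j, 0 <= F i j) ->
  (\int[P]_w ((Y w)%:R * ((1 - p) * F (X w) (Y w) + p * F (X w) (Y w).+1))%:E =
   \int[P]_w (M%:R * p * F (X w) (Y w).+1)%:E)%E.
Proof.
move=> p01 Yb F0; have /andP[p0 p1] := p01.
have q0 : 0 <= 1 - p by rewrite subr_ge0.
rewrite (ge0_integral_indep (F := fun i j =>
  (j%:R * ((1 - p) * F i j + p * F i j.+1))%:E) indepXY);
  last by move=> i j; rewrite lee_fin mulr_ge0// addr_ge0// mulr_ge0.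
rewrite (ge0_integral_indep (F := fun i j => (M%:R * p * F i j.+1)%:E) indepXY);
  last by move=> i j; rewrite lee_fin !mulr_ge0.
apply: eq_eseriesr => i _.
set a := distribution P X [set i].
have a0 : (0 <= a)%E by exact: measure_ge0.
have b0 j : 0 <= binomial_pmf M p j by exact: binomial_pmf_ge0.
(* The two halves are separated because only the [1 - p] half is shifted: its term [j = 0] vanishes,
   and after the shift both halves carry [F i j.+1], where [binomial_pmfS] applies. *)
transitivity (\sum_(j <oo) (((1 - p) * j%:R * binomial_pmf M p j * F i j)%:E * a
  + (p * j%:R * binomial_pmf M p j * F i j.+1)%:E * a))%E.
  apply: eq_eseriesr => j _; rewrite (binomial_distributed1 _ p01 Yb).
  rewrite -ge0_muleDl ?lee_fin ?mulr_ge0// muleCA muleC -EFinM -EFinD.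
  by congr (_%:E * _)%E; ring.
rewrite nneseriesD; first last.
- by move=> j _ _; rewrite mule_ge0// lee_fin ?mulr_ge0.
- by move=> j _ _; rewrite mule_ge0// lee_fin ?mulr_ge0.
rewrite nneseries_shift; first last.
- by rewrite !(mulr0, mul0r) mul0e.
- by move=> j; rewrite mule_ge0// lee_fin ?mulr_ge0.
rewrite -nneseriesD; first last.
- by move=> j _ _; rewrite mule_ge0// lee_fin ?mulr_ge0.
- by move=> j _ _; rewrite mule_ge0// lee_fin ?mulr_ge0.
apply: eq_eseriesr => j _; rewrite (binomial_distributed1 _ p01 Yb).
rewrite -ge0_muleDl ?lee_fin ?mulr_ge0// -EFinD -mulrDl binomial_pmfS.
by rewrite [in RHS]muleCA [in RHS]muleC -EFinM; congr (_%:E * _)%E; ring.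
Qed.

Lemma poisson_binomial_stein (alpha : R) (M : nat) (p : R) (f : nat -> R) :
  0 < alpha -> poisson_distributed alpha X ->
  0 <= p <= 1 -> binomial_distributed M p Y -> (forall j, 0 <= f j) ->
  let S := addRV X Y in
  (\int[P]_w ((S w)%:R * ((1 - p) * f (S w) + p * f (S w).+1))%:E =
   \int[P]_w (M%:R * p * f (S w).+1 +
              alpha * ((1 - p) * f (S w).+1 + p * f (S w).+2))%:E)%E.
Proof.
move=> a0 Xa p01 Yb f0 S; have /andP[p0 p1] := p01.
have q0 : 0 <= 1 - p by rewrite subr_ge0.
have mX : measurable_fun setT X by exact: measurable_funPT.
have mY : measurable_fun setT Y by exact: measurable_funPT.
pose g (i j : nat) := (1 - p) * f (i + j)%N + p * f (i + j).+1.
have g0 i j : 0 <= g i j by rewrite addr_ge0// mulr_ge0.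
(* The factor [S] is split into its summands. The [X] part takes the Poisson identity with the
   averaged function [g]; in the [Y] part the averaging is exactly the one of the binomial identity,
   which is therefore applied to [f]. *)
transitivity (\int[P]_w ((Y w)%:R * g (X w) (Y w))%:E +
              \int[P]_w ((X w)%:R * g (X w) (Y w))%:E)%E.
  rewrite -ge0_integralD//.
  - by apply: eq_integral => w _; rewrite /S /addRV natrD -EFinD /g; congr EFin; ring.
  - by move=> w _; rewrite lee_fin mulr_ge0.
  - exact: (measurable_fun_nat2 (fun i j => (j%:R * g i j)%:E)).
  - by move=> w _; rewrite lee_fin mulr_ge0.
  - exact: (measurable_fun_nat2 (fun i j => (i%:R * g i j)%:E)).
rewrite (poisson_stein a0 Xa g0).
have -> : (\int[P]_w ((Y w)%:R * g (X w) (Y w))%:E =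
  \int[P]_w (M%:R * p * f (X w + Y w).+1)%:E)%E.
  have := binomial_stein (F := fun i j => f (i + j)%N) p01 Yb (fun i j => f0 _).
  under eq_integral do rewrite addnS.
  by under [in X in _ = X]eq_integral do rewrite addnS.
rewrite -ge0_integralD//.
- by move=> w _; rewrite lee_fin !mulr_ge0.
- exact: (measurable_fun_nat2 (fun i j => (M%:R * p * f (i + j).+1)%:E)).
- by move=> w _; rewrite lee_fin mulr_ge0// ltW.
- exact: (measurable_fun_nat2 (fun i j => (alpha * g i.+1 j)%:E)).
Qed.

End stein_identities.

(** * Integrability and vanishing expectation of the kernel *)

Lemma integrable_linear_growth (d : measure_display) (T : measurableType d)
    (R : realType) (P : probability T R) (S : {RV P >-> nat}) (H : nat -> R)
    (C : R) :
  P.-integrable [set: T] (fun w => ((S w)%:R : R)%:E) ->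
  (forall j, `|H j| <= C * j.+1%:R) ->
  P.-integrable [set: T] (fun w => (H (S w))%:E).
Proof.
move=> iS HC; have mS : measurable_fun setT S by exact: measurable_funPT.
apply: (@le_integrable _ _ _ _ _ _ _ (fun w => C%:E * (1 + ((S w)%:R)%:E))%E) => //.
- exact: (measurable_fun_nat2 (fun j _ => (H j)%:E) mS mS).
- move=> w _; rewrite -EFinD -EFinM !abse_EFin lee_fin nat1r.
  exact: le_trans (HC _) (ler_norm _).
- apply: integrableZl => //; apply: integrableD => //.
  exact: finite_measure_integrable_cst.
Qed.

Section stein_kernel.
Context (d : measure_display) (T : measurableType d) (R : realType)
  (P : probability T R) (X Y : {RV P >-> nat}) (alpha : R) (M : nat) (p : R).
Hypotheses (indepXY : independent_RV X Y) (a0 : 0 < alpha) (p01 : 0 <= p <= 1)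
  (Xa : poisson_distributed alpha X) (Yb : binomial_distributed M p Y).

Let S : {RV P >-> nat} := addRV X Y.

(** The identity with [f = 1] evaluates the mean as [M p + alpha]; being an equality in the extended
    reals, it proves finiteness at the same time. *)
Lemma integrable_poisson_binomial :
  P.-integrable [set: T] (fun w => ((S w)%:R : R)%:E).
Proof.
have mS : measurable_fun setT S by exact: measurable_funPT.
apply/integrableP; split.
  exact: (measurable_fun_nat2 (fun j _ => (j%:R : R)%:E) mS mS).
have ES : (\int[P]_w ((S w)%:R : R)%:E = (M%:R * p + alpha)%:E)%E.
  have := poisson_binomial_stein indepXY a0 Xa p01 Yb (fun=> ler01).
  under [in X in _ = X -> _]eq_integral do rewrite !mulr1 subrK mulr1.
  rewrite integral_cst// [X in (_ * X)%E]probability_setT mule1 => <-.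
  by apply: eq_integral => w _; rewrite !mulr1 subrK mulr1.
under eq_integral do rewrite abse_EFin ger0_norm//.
by rewrite ES ltry.
Qed.

(** The pointwise difference of the two integrands of [poisson_binomial_stein]; on the Stein class
    both operators take this form for a suitable bounded [f]. *)
Definition stein_kernel (f : nat -> R) (j : nat) : R :=
  j%:R * ((1 - p) * f j + p * f j.+1) -
  (M%:R * p * f j.+1 + alpha * ((1 - p) * f j.+1 + p * f j.+2)).

Lemma integrable_stein_kernel (f : nat -> R) (C : R) :
  (forall j, `|f j| <= C) ->
  P.-integrable [set: T] (fun w => (stein_kernel f (S w))%:E).
Proof.
move=> fC; have /andP[p0 p1] := p01.
have q0 : 0 <= 1 - p by rewrite subr_ge0.
have C0 : 0 <= C by apply: le_trans (fC 0%N).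
have conv x y : `|x| <= C -> `|y| <= C -> `|(1 - p) * x + p * y| <= C.
  move=> xC yC; apply: le_trans (ler_normD _ _) _.
  rewrite !normrM (ger0_norm p0) (ger0_norm q0).
  have := ler_wpM2l q0 xC; have := ler_wpM2l p0 yC; lra.
apply: (integrable_linear_growth (C := C + M%:R * p * C + alpha * C)).
  exact: integrable_poisson_binomial.
move=> j; rewrite /stein_kernel.
have Mp0 : 0 <= M%:R * p by rewrite mulr_ge0.
have E1 : `|j%:R * ((1 - p) * f j + p * f j.+1)| <= C * j%:R.
  by rewrite normrM normr_nat mulrC ler_wpM2r// conv.
have E2 : `|M%:R * p * f j.+1| <= M%:R * p * C.
  by rewrite normrM (ger0_norm Mp0) ler_wpM2l.
have E3 : `|alpha * ((1 - p) * f j.+1 + p * f j.+2)| <= alpha * C.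
  by rewrite normrM (gtr0_norm a0) ler_wpM2l ?conv// ltW.
apply: le_trans (ler_normB _ _) _.
apply: le_trans (lerD E1 (le_trans (ler_normD _ _) (lerD E2 E3))) _.
have : 0 <= (M%:R * p * C + alpha * C) * j%:R.
  by rewrite mulr_ge0// addr_ge0// mulr_ge0// ltW.
rewrite -nat1r; lra.
Qed.

Lemma expectation_stein_kernel_ge0 (f : nat -> R) (C : R) :
  (forall j, `|f j| <= C) -> (forall j, 0 <= f j) ->
  (\int[P]_w (stein_kernel f (S w))%:E = 0)%E.
Proof.
move=> fC f0; have /andP[p0 p1] := p01.
have q0 : 0 <= 1 - p by rewrite subr_ge0.
have mS : measurable_fun setT S by exact: measurable_funPT.
have C0 : 0 <= C by apply: le_trans (fC 0%N).
(* [u] is the right-hand integrand of the identity. It is integrable by itself, so its finite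
   integral may be subtracted from both sides. *)
pose u j : R := M%:R * p * f j.+1 + alpha * ((1 - p) * f j.+1 + p * f j.+2).
have iu : P.-integrable [set: T] (fun w => (u (S w))%:E).
  apply: (integrable_linear_growth (C := M%:R * p * C + alpha * C)) => [|j].
    exact: integrable_poisson_binomial.
  have fle k : f k <= C by exact: le_trans (ler_norm _) (fC k).
  rewrite ger0_norm; last first.
    by rewrite addr_ge0// ?mulr_ge0 ?addr_ge0 ?mulr_ge0// ltW.
  apply: (@le_trans _ _ (M%:R * p * C + alpha * C)).
    apply: lerD; first by rewrite ler_wpM2l ?mulr_ge0.
    rewrite ler_wpM2l ?(ltW a0)//.
    have := ler_wpM2l q0 (fle j.+1); have := ler_wpM2l p0 (fle j.+2); lra.
  by rewrite ler_peMr ?ler1n// addr_ge0 ?mulr_ge0// ltW.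
have E := poisson_binomial_stein indepXY a0 Xa p01 Yb f0.
transitivity (\int[P]_w ((stein_kernel f (S w) + u (S w))%:E - (u (S w))%:E))%E.
  by apply: eq_integral => w _; rewrite -EFinB addrK.
have Eku w : stein_kernel f (S w) + u (S w) =
    (S w)%:R * ((1 - p) * f (S w) + p * f (S w).+1).
  by rewrite /stein_kernel subrK.
rewrite integralB//; last first.
  by under eq_fun do rewrite EFinD; apply: integrableD => //;
    exact: integrable_stein_kernel fC.
under eq_integral do rewrite Eku.
by rewrite [X in (X - _)%E]E subee//; exact: integrable_fin_num iu.
Qed.

(** The kernel is linear in [f], and [f] is the difference of the nonnegative bounded functions
    [f + C] and [C]. *)
Lemma expectation_stein_kernel (f : nat -> R) (C : R) :
  (forall j, `|f j| <= C) -> (\int[P]_w (stein_kernel f (S w))%:E = 0)%E.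
Proof.
move=> fC; have C0 : 0 <= C by apply: le_trans (fC 0%N).
have fDC j : 0 <= f j + C.
  by have := fC j; rewrite ler_norml => /andP[+ _]; lra.
have fD2C j : `|f j + C| <= C + C.
  by apply: le_trans (ler_normD _ _) _; rewrite lerD// ger0_norm.
have normC (j : nat) : `|C| <= C by rewrite ger0_norm.
transitivity (\int[P]_w ((stein_kernel (fun j => f j + C) (S w))%:E -
    (stein_kernel (fun=> C) (S w))%:E))%E.
  by apply: eq_integral => w _; rewrite -EFinB /stein_kernel; congr EFin; ring.
rewrite integralB//; [|exact: integrable_stein_kernel fD2C|exact: integrable_stein_kernel normC].
rewrite (expectation_stein_kernel_ge0 fD2C fDC).
by rewrite (expectation_stein_kernel_ge0 normC (fun=> C0)) sube0.
Qed.

End stein_kernel.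

(* [limn (series (alt_series r g j))] is the bounded solution [h] of
   [h j + r * h j.+1 = r * g j.+1]; for [r = p / q] it inverts the shift
   [q + p z] of the first operator. *)
Definition alt_series (R : realType) (r : R) (g : nat -> R) (j l : nat) : R :=
  r * (- r) ^+ l * g (j + l).+1.

(** * The alternating series behind the second operator *)

Section alternating_series.
Context (R : realType) (r : R).
Hypotheses (r0 : 0 <= r) (r1 : r < 1).

Let norm_alt_series (g : nat -> R) (C : R) (j l : nat) :
  (forall x, `|g x| <= C) -> `|alt_series r g j l| <= geometric (C * r) r l.
Proof.
move=> gC; rewrite /alt_series /= !normrM normrX normrN (ger0_norm r0).
by rewrite mulrC mulrA ler_wpM2r ?exprn_ge0// ler_wpM2r.
Qed.

Let cvg_geo (C : R) : cvgn (series (geometric (C * r) r)).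
Proof. by apply: is_cvg_geometric_series; rewrite ger0_norm. Qed.

Let is_cvg_norm_alt_series (g : nat -> R) (C : R) (j : nat) :
  (forall x, `|g x| <= C) -> cvgn [normed series (alt_series r g j)].
Proof.
move=> gC; apply: (@series_le_cvg _ (fun l => `|alt_series r g j l|) _ _ _ _ (@cvg_geo C)) => // n; last first.
  exact: norm_alt_series.
by rewrite (le_trans _ (norm_alt_series j n gC)).
Qed.

Lemma is_cvg_alt_series (g : nat -> R) (C : R) (j : nat) :
  (forall x, `|g x| <= C) -> cvgn (series (alt_series r g j)).
Proof. by move=> gC; apply: normed_cvg; exact: is_cvg_norm_alt_series gC. Qed.

(** Comparison with a geometric series of ratio [r]. The bound is uniform in [j], which makes the
    solution [h] admissible as a kernel function. *)
Lemma lim_alt_series_bounded (g : nat -> R) (C : R) (j : nat) :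
  (forall x, `|g x| <= C) ->
  `|limn (series (alt_series r g j))| <= C * r / (1 - r).
Proof.
move=> gC; have cn := @is_cvg_norm_alt_series g C j gC.
rewrite (le_trans (lim_series_norm cn))//.
rewrite (le_trans (lim_series_le cn (@cvg_geo C) _))//.
  by move=> n; exact: norm_alt_series.
by rewrite (cvg_lim _ (cvg_geometric_series _))// ger0_norm.
Qed.

Lemma lim_alt_seriesS (g : nat -> R) (C : R) (j : nat) :
  (forall x, `|g x| <= C) ->
  limn (series (alt_series r g j)) =
  r * (g j.+1 - limn (series (alt_series r g j.+1))).
Proof.
move=> gC; apply/cvg_lim => //; rewrite -cvg_shiftS.
rewrite [X in X @ _ --> _](_ : _ =
    fun n => r * (g j.+1 - series (alt_series r g j.+1) n)).
  apply: cvgM; first exact: cvg_cst.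
  apply: cvgB; first exact: cvg_cst.
  exact: is_cvg_alt_series gC.
apply/funext => n; rewrite /series/= big_nat_recl// mulrBr mulr_sumr.
rewrite /alt_series expr0 mulr1 addn0 -sumrN; congr (_ + _).
by apply: eq_bigr => l _; rewrite exprS addnS addSn; ring.
Qed.

Lemma lim_alt_series_linear (a : R) (g h : nat -> R) (C D : R) (j : nat) :
  (forall x, `|g x| <= C) -> (forall x, `|h x| <= D) ->
  limn (series (alt_series r (fun x => a * g x + h x) j)) =
  a * limn (series (alt_series r g j)) + limn (series (alt_series r h j)).
Proof.
move=> gC hD; apply/cvg_lim => //.
rewrite [X in X @ _ --> _](_ : _ = fun n =>
    a * series (alt_series r g j) n + series (alt_series r h j) n).
  apply: cvgD; last exact: is_cvg_alt_series hD.
  by apply: cvgM; [exact: cvg_cst|exact: is_cvg_alt_series gC].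
apply/funext => n; rewrite /series/= mulr_sumr -big_split/=.
by apply: eq_bigr => l _; rewrite /alt_series; ring.
Qed.

Lemma cvg_alt_series1 (j : nat) :
  series (alt_series r (fun=> 1) j) @ \oo --> r / (1 + r).
Proof.
(* Writing [1 + r] as [1 - (- r)] exhibits the limit of a geometric series of ratio [- r]. *)
rewrite -[X in 1 + X]opprK.
rewrite (_ : alt_series _ _ _ = geometric r (- r)).
  by apply: cvg_geometric_series; rewrite normrN ger0_norm.
by apply/funext => l; rewrite /alt_series mulr1.
Qed.

(** The inner sum telescopes to [g (j + l) - g j.+1], and the coefficient of index [l] is that of
    [alt_series] at [l - 1]. The right side thus also contains [l = 1], where its two contributions
    cancel. *)
Lemma sum_stein_term (g : nat -> R) (j n : nat) :
  \sum_(2 <= l < n.+2)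
    (-1) ^+ l.+1 * r ^+ l * \sum_(1 <= k < l) fdiff g (j + k)%N =
  series (alt_series r g j) n.+1 -
  g j.+1 * series (alt_series r (fun=> 1) j) n.+1.
Proof.
have tele l : \sum_(1 <= k < l.+2) fdiff g (j + k)%N = g (j + l.+2)%N - g j.+1.
  rewrite -(addn1 j) -(telescope_sumr (fun k => g (j + k)%N) (ltn0Sn l.+1)).
  by apply: eq_bigr => k _; rewrite /fdiff addnS.
rewrite /series/=; elim: n => [|n IHn].
  by rewrite big_geq// !big_nat1 /alt_series expr0 addn0; ring.
rewrite big_nat_recr//= IHn tele.
rewrite ![in RHS](big_nat_recr n.+1)//= /alt_series !addnS.
rewrite (_ : (-1) ^+ n.+3 * r ^+ n.+2 = r * (- r) ^+ n.+1); first by ring.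
by rewrite [in RHS]exprNn !exprS; ring.
Qed.

Lemma cvg_stein_term (g : nat -> R) (C : R) (j : nat) :
  (forall x, `|g x| <= C) ->
  (fun n => \sum_(2 <= l < n)
    (-1) ^+ l.+1 * r ^+ l * \sum_(1 <= k < l) fdiff g (j + k)%N) @ \oo -->
  limn (series (alt_series r g j)) - g j.+1 * (r / (1 + r)).
Proof.
move=> gC; rewrite -(cvg_shiftn 2).
under eq_fun do rewrite addn2 sum_stein_term.
apply: cvgB; first by rewrite (cvg_shiftS (series _)); exact: is_cvg_alt_series gC.
apply: cvgM; first exact: cvg_cst.
by rewrite (cvg_shiftS (series _)); exact: cvg_alt_series1.
Qed.

End alternating_series.

(** * Probability generating function of the sum *)

Section pgf.
Context (d : measure_display) (T : measurableType d) (R : realType)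
  (P : probability T R) (X Y : {RV P >-> nat}) (alpha : R) (M : nat) (p : R).
Hypotheses (indepXY : independent_RV X Y) (a0 : 0 < alpha) (p01 : 0 <= p <= 1)
  (Xa : poisson_distributed alpha X) (Yb : binomial_distributed M p Y).

Let norm_pgf_binomial (z : R) : `|z| <= 1 -> `|((1 - p) + p * z) ^+ M| <= 1.
Proof.
move=> z1; have /andP[p0 p1] := p01.
rewrite normrX exprn_ile1// (le_trans (ler_normD _ _))//.
rewrite normrM (ger0_norm p0) (@ger0_norm _ (1 - p)) ?subr_ge0//.
have := ler_wpM2l p0 z1; lra.
Qed.

(** Since [z] may be negative, the power is offset by [1] to keep all terms nonnegative. The
    parameter [x] stands for the contribution of the other summand. *)
Let sum_binomial (x z : R) :
  `|x| <= 1 -> `|z| <= 1 ->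
  (\sum_(j <oo) ((1 + x * z ^+ j)%:E * (binomial_pmf M p j)%:E) =
   (1 + x * ((1 - p) + p * z) ^+ M)%:E)%E.
Proof.
move=> x1 z1.
have nneg j : 0 <= 1 + x * z ^+ j.
  have : `|x * z ^+ j| <= 1 by rewrite normrM normrX mulr_ile1 ?exprn_ile1 ?exprn_ge0.
  by rewrite ler_norml => /andP[+ _]; lra.
have mass (y : R) :
    \sum_(0 <= j < M.+1) y ^+ j * binomial_pmf M p j = ((1 - p) + p * y) ^+ M.
  rewrite exprDn big_mkord; apply: eq_bigr => j _.
  rewrite /binomial_pmf mulrnAr exprMn; congr (_ *+ _).
  by rewrite mulrC [RHS]mulrA [in RHS](mulrC _ (p ^+ j)).
rewrite (nneseries_split 0%N M.+1); last first.
  by move=> j _; rewrite mule_ge0// lee_fin// binomial_pmf_ge0.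
rewrite add0n eseries0 ?adde0; last first.
  by move=> j Mj _; rewrite /binomial_pmf bin_small// mulr0n mule0.
under eq_bigr do rewrite -EFinM mulrDl mul1r -mulrA.
rewrite sumEFin big_split/= -mulr_sumr mass; congr (_ + _)%:E.
(* The total mass is [mass] at [y = 1]. *)
rewrite -[RHS](expr1n _ M) -[in RHS](subrK p 1) -[X in _ + X]mulr1 -mass.
by under [RHS]eq_bigr do rewrite expr1n mul1r.
Qed.

Let sum_poisson (x z : R) : `|x| <= 1 -> `|z| <= 1 ->
  (\sum_(i <oo) ((1 + x * z ^+ i)%:E * (poisson_pmf alpha i)%:E) =
   (1 + x * expR (alpha * (z - 1)))%:E)%E.
Proof.
move=> x1 z1.
pose e := expR (- alpha).
(* The partial sums combine those of the exponential series at [alpha] and at [alpha * z]. *)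
transitivity (limn (EFin \o (fun n => (e * series (exp_coeff alpha) n +
    x * e * series (exp_coeff (alpha * z)) n)%R)))%E.
  apply/congr_lim/funext => n /=.
  under eq_bigr do rewrite -EFinM.
  rewrite sumEFin /series/= !mulr_sumr -big_split/=; congr EFin.
  apply: eq_bigr => i _.
  by rewrite /poisson_pmf a0 /exp_coeff/= exprMn -/e; ring.
apply/cvg_lim => //; apply: cvg_EFin; first by near=> n.
rewrite (_ : 1 + _ = e * expR alpha + x * e * expR (alpha * z)).
  by apply: cvgD; apply: cvgM; do ?exact: cvg_cst; exact: is_cvg_series_exp_coeff.
rewrite /e expRN mulVf ?gt_eqF ?expR_gt0// mulrBr mulr1 expRD -mulrA -expRN.
by rewrite [in LHS](mulrC (expR _)).
Unshelve. all: by end_near.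
Qed.

Lemma pgf_poisson_binomial (z : R) : `|z| <= 1 ->
  pgf (addRV X Y : {RV P >-> nat}) z =
  (((1 - p) + p * z) ^+ M * expR (alpha * (z - 1)))%:E.
Proof.
move=> z1; set S : {RV P >-> nat} := addRV X Y.
have zle1 k : `|z ^+ k| <= 1 by rewrite normrX exprn_ile1.
have nneg k : 0 <= 1 + z ^+ k.
  by have := zle1 k; rewrite ler_norml => /andP[+ _]; lra.
have iS := integrable_poisson_binomial indepXY a0 p01 Xa Yb.
have iz : P.-integrable [set: T] (fun w => (z ^+ S w)%:E).
  apply: (integrable_linear_growth (H := fun k => z ^+ k) (C := 1) iS) => j.
  by rewrite mul1r (le_trans (zle1 j))// ler1n.
have i1 : P.-integrable [set: T] (fun=> 1%E).
  exact: finite_measure_integrable_cst.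
have : (\int[P]_w (1 + z ^+ S w)%:E =
    (1 + ((1 - p) + p * z) ^+ M * expR (alpha * (z - 1)))%:E)%E.
  rewrite (ge0_integral_indep (F := fun i j => (1 + z ^+ (i + j))%:E) indepXY);
    last by move=> i j; rewrite lee_fin.
  (* The double sum is matched from outside in: the Poisson sum with [x] the binomial generating
     function, then for each [i] the binomial sum with [x = z ^+ i]. *)
  rewrite -sum_poisson ?norm_pgf_binomial//.
  apply: eq_eseriesr => i _; rewrite [in RHS]mulrC -sum_binomial//.
  rewrite [in RHS]muleC -nneseriesZl; last first.
    by move=> j _; rewrite mule_ge0// lee_fin ?binomial_pmf_ge0// -exprD.
  apply: eq_eseriesr => j _; rewrite exprD muleCA.
  by rewrite (poisson_distributed1 _ a0 Xa) (binomial_distributed1 _ p01 Yb).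
under eq_integral do rewrite EFinD.
rewrite integralD// integral_cst// [X in (_ * X)%E]probability_setT mule1.
rewrite EFinD /pgf unlock => /(congr1 (fun x => x - 1)%E).
by rewrite ![(1 + _)%E]addeC !addeK.
Qed.

End pgf.

(** * The Stein class and the two operators *)

Lemma stein_class_bounded (d : measure_display) (T : measurableType d)
    (R : realType) (P : probability T R) (S : {RV P >-> nat}) (g : nat -> R) :
  stein_class S g -> exists C : R, forall x, `|g x| <= C.
Proof.
case=> -[C [_ gC]] _ _; exists (C + 1) => x.
by apply: gC => //; rewrite ltrDl.
Qed.

Lemma stein_class_linear (d : measure_display) (T : measurableType d)
    (R : realType) (P : probability T R) (S : {RV P >-> nat}) (a : R)
    (g h : nat -> R) :
  stein_class S g -> stein_class S h -> stein_class S (fun x => a * g x + h x).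
Proof.
move=> Sg Sh; have [C gC] := stein_class_bounded Sg.
have [D hD] := stein_class_bounded Sh.
case: Sg Sh => [_ g0 gS] [_ h0 hS]; split; last 2 first.
- by rewrite g0 h0 mulr0 addr0.
- by move=> x Sx; rewrite gS// hS// mulr0 addr0.
exists (`|a| * C + D); split=> [|B CDB x _]; first exact: num_real.
apply: le_trans (ltW CDB); apply: le_trans (ler_normD _ _) _.
by rewrite normrM lerD// ler_wpM2l.
Qed.

(** Common reduction for both operators: beyond linearity, it remains to exhibit a bounded [f] whose
    kernel is [A g]. *)
Lemma is_stein_operator_kernel (d : measure_display) (T : measurableType d)
    (R : realType) (P : probability T R) (X Y : {RV P >-> nat}) (alpha : R)
    (M : nat) (p : R) (A : (nat -> R) -> nat -> R) :
  independent_RV X Y -> 0 < alpha -> 0 <= p <= 1 ->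
  poisson_distributed alpha X -> binomial_distributed M p Y ->
  let S : {RV P >-> nat} := addRV X Y in
  (forall (a : R) (g h : nat -> R), stein_class S g -> stein_class S h ->
    forall j, A (fun x => a * g x + h x) j = a * A g j + A h j) ->
  (forall g, stein_class S g -> exists (f : nat -> R) (C : R),
    (forall j, `|f j| <= C) /\ A g = stein_kernel alpha M p f) ->
  is_stein_operator S A.
Proof.
move=> XY a0 p01 Xa Yb S linA AE; split => //.
  exact: integrable_poisson_binomial XY a0 p01 Xa Yb.
move=> g /AE [f [C [fC ->]]]; split.
  exact: integrable_stein_kernel XY a0 p01 Xa Yb _ _ fC.
by rewrite unlock; exact: expectation_stein_kernel XY a0 p01 Xa Yb _ _ fC.
Qed.

Unset Implicit Arguments.

Theorem proposition2p2 (d : measure_display) (T : measurableType d)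
    (R : realType) (P : probability T R)
    (alpha : R) (halpha : 0 < alpha)
    (M : nat) (hM : (0 < M)%N)
    (p q : R) (hp0 : 0 < p) (hp1 : p < 1) (hq : q = 1 - p)
    (Y1 Y2 : {RV P >-> nat})
    (hY1 : poisson_distributed alpha Y1)
    (hY2 : binomial_distributed M p Y2)
    (hindep : independent_RV Y1 Y2) :
  let Y12 : {RV P >-> nat} := addRV Y1 Y2 in
  [/\ forall z : R, `|z| <= 1 ->
        pgf Y12 z = ((q + p * z) ^+ M * expR (alpha * (z - 1)))%:E,
      is_stein_operator Y12 (fun g j =>
        (M%:R * p + alpha - j%:R * p) * g j.+1 - j%:R * q * g j
        + p * alpha * fdiff g j.+1)
    & p < q ->
      let term (g : nat -> R) (j l : nat) : R :=
        (-1) ^+ l.+1 * (p / q) ^+ l * \sum_(1 <= k < l) fdiff g (j + k)%N in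
      (forall g j, stein_class Y12 g ->
         cvgn (fun n => \sum_(2 <= l < n) term g j l)) /\
      is_stein_operator Y12 (fun g j =>
        (alpha + M%:R * p) * g j.+1 - j%:R * g j
        + M%:R * \big[+%R/0]_(2 <= l <oo) term g j l)].
Proof.
move=> Y12; subst q.
have p01 : 0 <= p <= 1 by rewrite !ltW.
have p0 : p != 0 by rewrite gt_eqF.
have q0 : 1 - p != 0 by rewrite subr_eq0 gt_eqF.
split.
- exact: pgf_poisson_binomial hindep halpha p01 hY1 hY2.
- apply: (is_stein_operator_kernel hindep halpha p01 hY1 hY2).
    by move=> a g h _ _ j; rewrite /fdiff; ring.
  move=> g /stein_class_bounded[C gC]; exists (fun x => - g x), C; split.
    by move=> j; rewrite normrN.
  by apply/funext => j; rewrite /stein_kernel /fdiff; ring.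
- move=> pq term; set r := p / (1 - p).
  have r0 : 0 <= r by rewrite divr_ge0// ?subr_ge0 ltW.
  have r1 : r < 1 by rewrite ltr_pdivrMr ?mul1r// subr_gt0.
  (* Here [1 + r = 1 / (1 - p)], so the limit of the constant series is [p] itself. *)
  have r1p : r / (1 + r) = p by rewrite /r; field; rewrite subrK oner_eq0 q0.
  pose h g j : R := limn (series (alt_series r g j)).
  have cvg_term g j : stein_class Y12 g ->
      (fun n => \sum_(2 <= l < n) term g j l) @ \oo --> h g j - g j.+1 * p.
    move=> /stein_class_bounded[C gC]; rewrite -r1p.
    exact: cvg_stein_term gC.
  have lim_term g j : stein_class Y12 g ->
      \big[+%R/0]_(2 <= l <oo) term g j l = h g j - g j.+1 * p.
    by move=> Yg; apply/cvg_lim => //; exact: cvg_term.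
  split=> [g j Yg|]; first by apply/cvg_ex; eexists; exact: cvg_term.
  apply: (is_stein_operator_kernel hindep halpha p01 hY1 hY2).
    move=> a g g' Yg Yg' j.
    have Ygg' := stein_class_linear a Yg Yg'.
    rewrite !lim_term//.
    have [C gC] := stein_class_bounded Yg.
    have [C' gC'] := stein_class_bounded Yg'.
    by rewrite /h (lim_alt_series_linear r0 r1 _ _ gC gC'); ring.
  move=> g Yg; have [C gC] := stein_class_bounded Yg.
  (* The value at [0] is a free choice: the kernel meets [f 0] only at [j = 0], multiplied by
     [j]. *)
  exists (fun k => - p^-1 * (if k is j.+1 then h g j else 0)).
  exists (p^-1 * (C * r / (1 - r))); split.
    have D0 : 0 <= C * r / (1 - r).
      by rewrite (le_trans _ (lim_alt_series_bounded r0 r1 0 gC)).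
    move=> [|j]; first by rewrite mulr0 normr0 mulr_ge0 ?invr_ge0// ltW.
    rewrite normrM normrN (@ger0_norm _ p^-1) ?invr_ge0 ?(ltW hp0)//.
    by rewrite ler_wpM2l ?invr_ge0 ?(ltW hp0)//; exact: lim_alt_series_bounded.
  have hS k : (1 - p) * h g k = p * (g k.+1 - h g k.+1).
    by rewrite /h (lim_alt_seriesS r0 r1 _ gC) mulrA /r mulrCA divff// mulr1.
  (* The recursion, solved for the later value, reduces every [h] in the kernel to the earliest one
     and leaves a field identity. *)
  have h1 k : h g k.+1 = g k.+1 - p^-1 * (1 - p) * h g k.
    by rewrite -mulrA hS mulKf// opprB addrC subrK.
  apply/funext => j; rewrite lim_term// /stein_kernel.
  by case: j => [|j]; rewrite ?h1; field.
Qed.
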